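(* Let $(G,+)$ be a nontrivial compact connected metric abelian group with normalized Haar measure $\mu$. Suppose that $\psi:\mathbb N\to\mathbb N$ satisfies $\psi(n)=o(n)$. Then there exists a residual set $\mathcal R\subset\mathcal C_0(G)$ such that for every $f\in\mathcal R$ the set $$\left\{u\in G:\ \limsup_{n\to\infty}\frac{|S_{n,u}f(0)|}{\psi(n)}=+\infty\right\}$$ is residual in $G$.
   Context: $\mathbb N=\{1,2,3,\dots\}$. Fix a scalar field, $\mathbb R$ or $\mathbb C$ (either is allowed). $\mathcal C_0(G)$ is the space of continuous scalar-valued functions $f$ on $G$ with $\int_G f\,d\mu=0$, equipped with the sup norm. For $u,x\in G$ and $n\ge 1$, $S_{n,u}f(x)=\sum_{k=0}^{n-1}f(x+ku)$; in particular $S_{n,u}f(0)=\sum_{k=0}^{n-1}f(ku)$. A subset of a complete metric space is residual if it contains a countable intersection of dense open sets. *)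

(* Defs.v *)
From HB Require Import structures.
From mathcomp Require Import all_boot all_order all_algebra.
From mathcomp Require Import complex.
From mathcomp Require Import all_classical all_reals all_analysis.
From mathcomp Require Import measurable_realfun.

Set Implicit Arguments.
Unset Strict Implicit.
Unset Printing Implicit Defensive.

Import Order.TTheory GRing.Theory Num.Theory.
Import numFieldNormedType.Exports.

Local Open Scope classical_set_scope.
Local Open Scope ring_scope.

(* The scalar field is the field of real numbers R or the field of complex
   numbers R[i], selected by a scalar_kind. The modulus is R-valued, whereas the
   norm `|z| of z : scalar_field R k lives in scalar_field R k; of_real_modulus
   relates them. *)
Variant scalar_kind := real_scalars | complex_scalars.

Definition scalar_field (R : realType) (k : scalar_kind) : numFieldType :=
  match k with real_scalars => R | complex_scalars => R[i] end.

Definition modulus (R : realType) (k : scalar_kind) : scalar_field R k -> R :=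
  match k with
  | real_scalars => fun x : R => `|x|
  | complex_scalars => fun z : R[i] => Normc.normc z
  end.

Definition of_real (R : realType) (k : scalar_kind) : R -> scalar_field R k :=
  match k with
  | real_scalars => fun x : R => x
  | complex_scalars => fun x : R => real_complex R x
  end.

(* The metric is only required to induce the topology of the group; it need not
   be translation invariant. It is not an instance of metricType, which cannot
   be joined with zmodType outside of the library. *)
HB.mixin Record isCompactMetric (R : realType) T & Topological T := {
  gdist : T -> T -> R ;
  gdist_eq0 : forall x y, gdist x y = 0 <-> x = y ;
  gdist_sym : forall x y, gdist x y = gdist y x ;
  gdist_triangle : forall x y z, gdist x z <= gdist x y + gdist y z ;
  nbhs_gdist : forall x : T,
    nbhs x = filter_from [set e | 0 < e] (fun e => [set y | gdist x y < e]) ;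
  compact_space : compact [set: T]
}.

#[short(type="compactMetricZmodType")]
HB.structure Definition CompactMetricZmodule (R : realType) :=
  {T of TopologicalZmodule T & isCompactMetric R T}.

(* Measurable types are pointed in the library: the point is taken to be 0. *)
Definition pointed_at0 (G : zmodType) : Type := G.
HB.instance Definition _ (G : zmodType) := Choice.on (pointed_at0 G).
HB.instance Definition _ (G : zmodType) :=
  isPointed.Build (pointed_at0 G) (0 : G).

Definition borel (G : topologicalZmodType) :=
  g_sigma_algebraType (open : set (set (pointed_at0 G))).
HB.instance Definition _ (G : topologicalZmodType) := Measurable.on (borel G).

(* A translation-invariant Borel probability measure is the normalized Haar
   measure; regularity is automatic on a compact metric space. *)
Definition is_haar (R : realType) (G : topologicalZmodType)
    (mu : probability (borel G) R) :=
  forall (x : G) (A : set (borel G)), measurable A ->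
    mu [set x + y | y in A] = mu A.

Section scalar_integral.
Context (R : realType) (k : scalar_kind) (G : compactMetricZmodType R).
Variable mu : probability (borel G) R.
Local Open Scope complex_scope.

Definition scalar_integral : (G -> scalar_field R k) -> scalar_field R k :=
  match k with
  | real_scalars => fun f : G -> R => \int[mu]_x f x
  | complex_scalars => fun f : G -> R[i] =>
      (\int[mu]_x complex.Re (f x)) +i* (\int[mu]_x complex.Im (f x))
  end.
End scalar_integral.

Section scalar_theory.
Context (R : realType).

Lemma of_real_modulus k (z : scalar_field R k) : of_real k (modulus z) = `|z|.
Proof. by case: k z => //= -[a b]; rewrite normc_def. Qed.

Lemma ler_of_real k (a b : R) : (of_real k a <= of_real k b) = (a <= b).
Proof. by case: k => //=; rewrite lecR. Qed.

Lemma ltr_of_real k (a b : R) : (of_real k a < of_real k b) = (a < b).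
Proof. by case: k => //=; rewrite ltcR. Qed.

Lemma of_realD k (a b : R) : of_real k (a + b) = of_real k a + of_real k b.
Proof. by case: k => //=; rewrite rmorphD. Qed.

Lemma of_realM k (a b : R) : of_real k (a * b) = of_real k a * of_real k b.
Proof. by case: k => //=; rewrite rmorphM. Qed.

Lemma of_real0 k : of_real k (0 : R) = 0.
Proof. by case: k. Qed.

Lemma of_real_inj k : injective (@of_real R k).
Proof. by case: k => [//|/=]; exact: complexI. Qed.

Lemma modulus_ge0 k (z : scalar_field R k) : 0 <= modulus z.
Proof. by rewrite -(ler_of_real k) of_real_modulus of_real0. Qed.

Lemma modulusD k (y z : scalar_field R k) : modulus (y + z) <= modulus y + modulus z.
Proof. by rewrite -(ler_of_real k) of_realD !of_real_modulus ler_normD. Qed.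

Lemma modulusM k (y z : scalar_field R k) : modulus (y * z) = modulus y * modulus z.
Proof. by apply: (@of_real_inj k); rewrite of_realM !of_real_modulus normrM. Qed.

Lemma modulus0_eq0 k (z : scalar_field R k) : modulus z = 0 -> z = 0.
Proof. by move=> z0; apply/normr0_eq0; rewrite -of_real_modulus z0 of_real0. Qed.

Lemma modulusB k (y z : scalar_field R k) : modulus (y - z) = modulus (z - y).
Proof. by apply: (@of_real_inj k); rewrite !of_real_modulus distrC. Qed.

Lemma lipschitz_continuous k (h : scalar_field R k -> R) :
  (forall y z, `|h y - h z| <= modulus (y - z)) -> continuous h.
Proof.
move=> hl y; apply: (iffRL (@cvgrPdist_lt _ _ _ _ (nbhs_filter y) _ _)).
move=> e e0; apply/nbhs_ballP.
exists (of_real k e); first by rewrite /= -(of_real0 k) ltr_of_real.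
move=> z; rewrite -ball_normE /= -of_real_modulus ltr_of_real.
exact: le_lt_trans.
Qed.

Lemma modulus_continuous k : continuous (@modulus R k).
Proof.
apply: lipschitz_continuous => y z; rewrite ler_norml; apply/andP; split.
  rewrite lerNl opprB lerBlDr -[X in modulus X <= _](subrK y z).
  by rewrite (modulusB y z) modulusD.
by rewrite lerBlDr -[X in modulus X <= _](subrK z y) modulusD.
Qed.

Lemma Re_continuous : continuous (@complex.Re R : scalar_field R complex_scalars -> R).
Proof.
apply: lipschitz_continuous => -[a b] [c d] /=.
by rewrite -sqrtr_sqr ler_wsqrtr// lerDl sqr_ge0.
Qed.

Lemma Im_continuous : continuous (@complex.Im R : scalar_field R complex_scalars -> R).
Proof.
apply: lipschitz_continuous => -[a b] [c d] /=.
by rewrite -sqrtr_sqr ler_wsqrtr// lerDr sqr_ge0.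
Qed.

End scalar_theory.

Section mean_zero.
Context (R : realType) (k : scalar_kind) (G : compactMetricZmodType R).
Variable mu : probability (borel G) R.

Lemma continuous_bounded (h : G -> R) : continuous h ->
  bounded_set (range h).
Proof.
move=> ch; apply: compact_bounded; apply: continuous_compact.
  exact: continuous_subspaceT.
exact: compact_space.
Qed.

Lemma continuous_measurable (h : G -> R) : continuous h ->
  measurable_fun [set: borel G] (h : borel G -> R).
Proof.
move=> /continuousP ch.
apply: (measurability _ (RGenOpens.measurableE R)).
move=> _ [_ [x [y ->]] <-]; rewrite setTI; apply: sub_sigma_algebra.
exact/ch/interval_open.
Qed.

Lemma continuous_integrable (h : G -> R) : continuous h ->
  mu.-integrable setT (EFin \o (h : borel G -> R)).
Proof.
move=> ch; apply: measurable_bounded_integrable => //.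
- by rewrite (@le_lt_trans _ _ 1%E) ?probability_le1 ?ltry.
- exact: continuous_measurable.
- have [M [Mr MP]] := continuous_bounded ch.
  exists M; split => // x Mx y _; apply: MP => //=; by exists y.
Qed.


Lemma Rintegral_lin3 (r1 r2 : R) (h1 h2 h3 : G -> R) :
  continuous h1 -> continuous h2 -> continuous h3 ->
  \int[mu]_(x in [set: borel G]) (r1 * h1 x + r2 * h2 x + h3 x) =
  r1 * \int[mu]_(x in [set: borel G]) h1 x +
  r2 * \int[mu]_(x in [set: borel G]) h2 x + \int[mu]_(x in [set: borel G]) h3 x.
Proof.
have cZ (r : R) (h : G -> R) : continuous h -> continuous (fun x => r * h x).
  by move=> ch x; apply: cvgMl_tmp; exact: ch.
move=> c1 c2 c3; have c12 : continuous (fun x => r1 * h1 x + r2 * h2 x).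
  by move=> x; apply: (@cvgD _ R^o); exact: cZ.
rewrite RintegralD//; [|exact: continuous_integrable..].
rewrite RintegralD//; [|exact/continuous_integrable/cZ..].
by rewrite !RintegralZl//; exact: continuous_integrable.
Qed.

Lemma scalar_integral_lin (a : scalar_field R k) (f g : G -> scalar_field R k) :
  continuous f -> continuous g ->
  scalar_integral mu (a *: f + g) =
  a * scalar_integral mu f + scalar_integral mu g.
Proof.
rewrite /scalar_integral; case: k a f g => [a f g cf cg|a f g cf cg] /=.
- have := Rintegral_lin3 a 0 cf cf cg; rewrite mul0r addr0 => <-.
  by apply: eq_Rintegral => x _; rewrite mul0r addr0.
- have cRe (h : G -> scalar_field R complex_scalars) : continuous h ->
      continuous (fun x => complex.Re (h x)).
    by move=> ch x; apply: continuous_comp; [exact: ch|exact: Re_continuous].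
  have cIm (h : G -> scalar_field R complex_scalars) : continuous h ->
      continuous (fun x => complex.Im (h x)).
    by move=> ch x; apply: continuous_comp; [exact: ch|exact: Im_continuous].
  case: a => a b; apply/eqP; rewrite eq_complex /=; apply/andP; split; apply/eqP.
    rewrite -mulNr -Rintegral_lin3; [|by [exact: cRe|exact: cIm]..].
    apply: eq_Rintegral => x _; rewrite -[(_ + _) x]/((a +i* b)%C * f x + g x).
    by case: (f x) => ? ?; case: (g x) => ? ? /=; rewrite mulNr.
  rewrite -Rintegral_lin3; [|by [exact: cRe|exact: cIm]..].
  apply: eq_Rintegral => x _; rewrite -[(_ + _) x]/((a +i* b)%C * f x + g x).
  by case: (f x) => ? ?; case: (g x) => ? ? /=.
Qed.

Definition mean_zero : {pred G -> scalar_field R k} :=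
  fun f => `[< continuous f /\ scalar_integral mu f = 0 >].

Lemma mean_zero_submod_closed : submod_closed mean_zero.
Proof.
split.
  apply/asboolP; split; first exact: cst_continuous.
  have c0 : continuous (0 : G -> scalar_field R k) by exact: cst_continuous.
  have := scalar_integral_lin 1 c0 c0.
  rewrite scale1r mul1r addr0 => /eqP.
  by rewrite -subr_eq0 opprD addrA subrr sub0r oppr_eq0 => /eqP.
move=> a f g /asboolP[cf f0] /asboolP[cg g0]; apply/asboolP; split.
  move=> x; apply: (@cvgD _ (scalar_field R k)^o); last exact: cg.
  by apply: cvgMl_tmp; exact: cf.
by rewrite scalar_integral_lin// f0 g0 mulr0 addr0.
Qed.

HB.instance Definition _ := GRing.isSubmodClosed.Build _ _ mean_zero
  mean_zero_submod_closed.

Record contMeanZero := ContMeanZero {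
  contMeanZero_fun :> G -> scalar_field R k ;
  contMeanZeroP : contMeanZero_fun \in mean_zero
}.
HB.instance Definition _ := [isSub for contMeanZero_fun].
HB.instance Definition _ := [Choice of contMeanZero by <:].
HB.instance Definition _ := [SubChoice_isSubLmodule of contMeanZero by <:].

Lemma contMeanZero_continuous (f : contMeanZero) : continuous f.
Proof. by have /asboolP[] := contMeanZeroP f. Qed.

(* The norm `|f| of the normed module contMeanZero below is
   of_real k (supnorm f). *)
Definition supnorm (f : contMeanZero) : R := sup (range (fun x => modulus (f x))).

Lemma has_sup_modulus (f : contMeanZero) :
  has_sup (range (fun x => modulus (f x))).
Proof.
split; first by exists (modulus (f 0)); exists 0.
have /continuous_bounded[M [_ MP]] : continuous (fun x => modulus (f x)).
  move=> x; apply: continuous_comp; first exact: contMeanZero_continuous.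
  exact: modulus_continuous.
exists (M + 1) => _ [x _ <-].
by apply: le_trans (ler_norm _) (MP _ _ _ _); [rewrite ltrDl|exists x].
Qed.

Lemma le_supnorm (f : contMeanZero) x : modulus (f x) <= supnorm f.
Proof. by apply: ub_le_sup; [case: (has_sup_modulus f)|exists x]. Qed.

Lemma supnorm_le (f : contMeanZero) (M : R) :
  (forall x, modulus (f x) <= M) -> supnorm f <= M.
Proof.
move=> fM; apply: ge_sup; first by case: (has_sup_modulus f).
by move=> _ [x _ <-].
Qed.

Lemma supnormD (f g : contMeanZero) :
  of_real k (supnorm (f + g)) <= of_real k (supnorm f) + of_real k (supnorm g).
Proof.
rewrite -of_realD ler_of_real; apply: supnorm_le => x.
by apply: le_trans (modulusD _ _) _; apply: lerD; exact: le_supnorm.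
Qed.

Lemma supnormZ (a : scalar_field R k) (f : contMeanZero) :
  of_real k (supnorm (a *: f)) = `|a| * of_real k (supnorm f).
Proof.
rewrite -of_real_modulus -of_realM; congr of_real; apply/eqP.
rewrite eq_le; apply/andP; split.
  apply: supnorm_le => x; rewrite [modulus _]modulusM.
  by rewrite ler_wpM2l ?modulus_ge0 ?le_supnorm.
have [->|a0] := eqVneq (modulus a) 0.
  by rewrite mul0r (le_trans (modulus_ge0 _) (le_supnorm _ 0)).
have {}a0 : 0 < modulus a by rewrite lt0r a0 modulus_ge0.
rewrite -ler_pdivlMl//; apply: supnorm_le => x.
by rewrite ler_pdivlMl// -modulusM; exact: (le_supnorm (a *: f)).
Qed.

Lemma supnorm0_eq0 (f : contMeanZero) : of_real k (supnorm f) = 0 -> f = 0.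
Proof.
rewrite -(of_real0 _ k) => /of_real_inj f0; apply/val_inj/funext => x.
apply/modulus0_eq0/eqP; rewrite eq_le modulus_ge0 andbT -f0.
exact: le_supnorm.
Qed.

HB.instance Definition _ :=
  Lmodule_isNormed.Build (scalar_field R k) contMeanZero supnormD supnormZ supnorm0_eq0.

End mean_zero.

Definition residual (T : topologicalType) (A : set T) :=
  exists U : (set T)^nat,
    (forall n, open (U n) /\ dense (U n)) /\ \bigcap_n U n `<=` A.

Definition birkhoff_sum (G V : zmodType) (n : nat) (u : G) (f : G -> V) (x : G) : V :=
  \sum_(m < n) f (x + u *+ m).

(* Main.v *)
Require Import Defs.
From HB Require Import structures.
From mathcomp Require Import all_boot all_order all_algebra.
From mathcomp Require Import complex ring lra.
From mathcomp Require Import all_classical all_reals all_analysis.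

Set Implicit Arguments.
Unset Strict Implicit.
Unset Printing Implicit Defensive.

Import Order.TTheory GRing.Theory Num.Theory.
Import numFieldNormedType.Exports.

Local Open Scope classical_set_scope.
Local Open Scope ring_scope.

(* A nontrivial connected metric group is infinite, so Haar measure has no
   atoms and any finite piece {m u : m < n} of an orbit carries a mean-zero
   continuous function h with |h| <= e and h >= e/2 at every point of it. One
   of f + h, f - h then has a Birkhoff sum at 0 of modulus at least n e/2, which
   exceeds N psi(n) for n large because psi(n) = o(n). Hence for every N and
   every nonempty open V, the functions f having some u in V and n > N with
   |S_{n,u} f(0)| > N psi(n) form a dense open set; intersecting over N and over
   countably many balls V of arbitrarily small radius covering G gives the
   residual set. *)

(** * Topology of the compact metric group *)

Section compact_metric_group.
Context (R : realType) (G : compactMetricZmodType R).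

Lemma gdistxx (x : G) : gdist x x = 0.
Proof. exact/gdist_eq0. Qed.

Lemma gdist_ge0 (x y : G) : 0 <= gdist x y.
Proof.
have := gdist_triangle x y x; rewrite gdistxx (gdist_sym y x) -mulr2n.
by rewrite pmulrn_lge0.
Qed.

Lemma gdist_gt0 (x y : G) : x != y -> 0 < gdist x y.
Proof.
by move=> xy; rewrite lt0r gdist_ge0 andbT; apply: contra_neq xy => /gdist_eq0.
Qed.

Lemma nbhs_gdist_lt (x : G) (e : R) : 0 < e -> nbhs x [set y | gdist x y < e].
Proof. by move=> e0; rewrite nbhs_gdist; exists e. Qed.

Lemma gdist_continuous (p : G) : continuous (fun x : G => gdist x p).
Proof.
move=> x; apply/(@cvgrPdist_lt _ _ _ _ (nbhs_filter x)) => e e0.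
apply: filterS (nbhs_gdist_lt x e0) => y /= xy; apply: le_lt_trans xy.
rewrite ler_distlC; apply/andP; split.
- by rewrite lerBlDl gdist_triangle.
- by rewrite addrC (gdist_sym x y) gdist_triangle.
Qed.

Lemma gdist_ball_open (p : G) (e : R) : open [set x | gdist x p < e].
Proof.
exact: (open_comp (D := [set r : R | r < e]) (in1W (@gdist_continuous p))
  (@open_lt _ e)).
Qed.

Lemma gdist_finite_closed (A : set G) : finite_set A -> closed A.
Proof.
apply: (iffLR accessible_finite_set_closed) => x y xy.
exists [set z | gdist z x < gdist x y]; split.
- exact: gdist_ball_open.
- by rewrite inE /= gdistxx gdist_gt0.
- by rewrite inE /= gdist_sym ltxx.
Qed.

(** Were the group finite, all its subsets would be closed, so {0} would be clopen and connectedness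
    would make it the whole group. *)
Lemma connected_nontrivial_infinite : connected [set: G] ->
  (exists x : G, x != 0) -> infinite_set [set: G].
Proof.
move=> conG [x x0] finG.
have zeroT : [set 0 : G] = [set: G].
  apply: (conG [set 0]); first by exists 0.
  - exists ([set 0] : set G); last by rewrite setTI.
    rewrite -(setCK [set 0]); apply: closed_openC.
    by apply: gdist_finite_closed; apply: sub_finite_set finG.
  - exists ([set 0] : set G); last by rewrite setTI.
    by apply: gdist_finite_closed; exact: finite_set1.
have : [set 0 : G] x by rewrite zeroT.
by move/eqP; rewrite (negbTE x0).
Qed.

Lemma finite_net (e : R) : 0 < e ->
  exists s : seq G, forall x, exists2 p, p \in s & gdist x p < e.
Proof.
(* The cover form of compactness is applied to a pointed space, so [G] is equipped with the point
   0. *)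
move=> e0; pose PG : ptopologicalType := HB.pack_for ptopologicalType (G : Type)
  (TopologicalZmodule.on G) (isPointed.Build G 0).
have : compact [set: PG] by exact: compact_space.
rewrite compact_cover => /(_ G setT (fun p => [set x | gdist x p < e]))[|x _|].
- by move=> p _; exact: gdist_ball_open.
- by exists x => //=; rewrite gdistxx.
- move=> D _ DG; exists (finmap.enum_fset D) => x.
  by have [p pD xp] := DG x I; exists p.
Qed.

Lemma mulrn_continuous n : continuous (fun u : G => u *+ n).
Proof.
elim: n => [|n IHn]; first exact: cst_continuous.
have -> : (fun u : G => u *+ n.+1) = (fun u => u + u *+ n).
  by apply/funext => u; rewrite mulrS.
move=> u; apply: (@continuous2_cvg _ G G G _ _ id (fun v => v *+ n) +%R).
- exact: (@add_continuous G (u, u *+ n)).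
- exact: cvg_id.
- exact: IHn.
Qed.

Lemma birkhoff_sum_continuous (K : numFieldType) (f : G -> K) n (x : G) :
  continuous f -> continuous (fun u => birkhoff_sum n u f x).
Proof.
move=> cf; elim: n => [|n IHn].
  have -> : (fun u => birkhoff_sum 0 u f x) = cst 0.
    by apply/funext => u; rewrite /birkhoff_sum big_ord0.
  exact: cst_continuous.
have -> : (fun u => birkhoff_sum n.+1 u f x) =
    (fun u => birkhoff_sum n u f x + f (x + u *+ n)).
  by apply/funext => u; rewrite /birkhoff_sum big_ord_recr.
move=> u; apply: (@cvgD _ K^o); first exact: IHn.
apply: (@continuous_comp _ _ _ (fun v => x + v *+ n) f); last exact: cf.
apply: (@continuous2_cvg _ G G G _ _ (cst x) (fun v => v *+ n) +%R).
- exact: (@add_continuous G (x, u *+ n)).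
- exact: cvg_cst.
- exact: mulrn_continuous.
Qed.

End compact_metric_group.

(** * Null points and bump functions of small integral *)

Section haar_bump.
Context (R : realType) (G : compactMetricZmodType R).
Variable mu : probability (borel G) R.
Hypotheses (mu_haar : is_haar mu) (infG : infinite_set [set: G]).

Lemma borel_set1 (x : G) : measurable ([set x] : set (borel G)).
Proof.
rewrite -[X in measurable X]setCK; apply: measurableC; apply: sub_sigma_algebra.
by apply: closed_openC; apply: gdist_finite_closed; exact: finite_set1.
Qed.

(** By invariance all points have the same mass r. An infinite group contains n distinct points for
    every n, so n r <= 1 for every n, which forces r = 0. *)
Lemma haar_set1 (x : G) : mu [set x] = 0%E.
Proof.
have mu_const y : mu [set y] = mu [set 0].
  rewrite -(mu_haar y (borel_set1 0)); congr (mu _).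
  by rewrite image_set1 addr0.
have /infiniteP/(@pcard_leP _ (pointed_at0 G))[f] := infG.
have finj : injective f by move=> i j; apply: inj; rewrite inE.
have mu0_fin : mu [set 0] \is a fin_num.
  by apply: fin_num_measure; exact: borel_set1.
have mulrn_le1 n : fine (mu [set 0]) *+ n <= 1.
  pose F i : set (borel G) := [set f i].
  have mF i : measurable (F i) by exact: borel_set1.
  have tF : trivIset setT F.
    by move=> i j _ _ [y [/= -> /finj]].
  have -> : fine (mu [set 0]) *+ n = fine (mu (\big[setU/set0]_(i < n) F i)).
    rewrite measure_bigsetU// (eq_bigr (fun=> (fine (mu [set 0]))%:E)) => [|i _].
      by rewrite sumEFin sumr_const card_ord.
    by rewrite fineK//; exact: mu_const.
  have mFn : measurable (\big[setU/set0]_(i < n) F i).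
    by apply: bigsetU_measurable => i _; exact: mF.
  by rewrite -lee_fin fineK ?probability_le1// fin_num_measure.
rewrite mu_const -(fineK mu0_fin); congr EFin; apply/eqP.
rewrite eq_le fine_ge0// andbT leNgt; apply/negP => r0.
(* If r > 0, this number of points exceeds 1/r, so their total mass exceeds 1. *)
have := mulrn_le1 (Num.truncn (fine (mu [set 0]))^-1).+1.
rewrite -mulr_natl -ler_pdivlMr// div1r leNgt => /negP; apply.
exact: truncnS_gt.
Qed.

Lemma haar_ae_notin (s : seq G) : \forall x \ae mu, (x : G) \notin s.
Proof.
elim: s => [|p s IHs]; first exact: aeW.
have p_ae : \forall x \ae mu, (x : G) != p.
  exists [set p]; split; [exact: borel_set1|exact: haar_set1|].
  by move=> x /= /negP; rewrite negbK => /eqP.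
apply: (@filterS2 _ _ (ae_filter_ringOfSetsType mu) _ _ _ _ p_ae IHs) => x xp xs.
by rewrite inE negb_or xp.
Qed.

(** The product [P] of the distances to the points of [s] vanishes exactly on [s]. Hence 1/(1 + j P)
    is 1 on [s] and tends to 0 off this null set, and its integral tends to 0 by dominated
    convergence. *)
Lemma haar_bump (s : seq G) (e : R) : 0 < e -> exists phi : G -> R,
  [/\ continuous phi, forall x, 0 <= phi x <= 1,
      {in s, forall p, phi p = 1} & \int[mu]_(x in [set: borel G]) phi x < e].
Proof.
move=> e0; pose P (x : G) := \prod_(p <- s) gdist x p.
have P_ge0 x : 0 <= P x by apply: prodr_ge0 => p _; exact: gdist_ge0.
have P_cont : continuous P.
  rewrite /P; elim: s {P P_ge0} => [|p s IHs].
    have -> : (fun x : G => \prod_(q <- [::]) gdist x q) = cst 1.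
      by apply/funext => x; rewrite big_nil.
    exact: cst_continuous.
  have -> : (fun x : G => \prod_(q <- p :: s) gdist x q) =
      (fun x => gdist x p * \prod_(q <- s) gdist x q).
    by apply/funext => x; rewrite big_cons.
  by move=> x; apply: cvgM; [exact: gdist_continuous|exact: IHs].
(* [phi j] decreases to the indicator function of the null set [s]. *)
pose phi (j : nat) x := (1 + j%:R * P x)^-1.
have den_ge1 j x : 1 <= 1 + j%:R * P x by rewrite lerDl mulr_ge0.
have phi_cont j : continuous (phi j).
  move=> x; apply: cvgV; first by rewrite gt_eqF// (lt_le_trans ltr01).
  apply: cvgD; first exact: cvg_cst.
  by apply: cvgM; [exact: cvg_cst|exact: P_cont].
have phi01 j x : 0 <= phi j x <= 1.
  by rewrite invr_ge0 (le_trans ler01)//= invf_le1// (lt_le_trans ltr01).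
have phi_to0 x : x \notin s -> phi j x @[j --> \oo] --> 0.
  move=> xs; have Px0 : 0 < P x.
    rewrite /P big_seq; apply: prodr_gt0 => p ps; apply: gdist_gt0.
    by apply: contraNneq xs => ->.
  apply/(gtr0_cvgV0 (f := fun j => 1 + j%:R * P x)).
    by apply: nearW => j; exact: lt_le_trans ltr01 (den_ge1 j x).
  apply/cvgryPge => A; have /cvgryPge/(_ (A / P x)) := @cvgr_idn R.
  apply: filterS => j; rewrite ler_pdivrMr// => /le_trans; apply.
  by rewrite lerDr.
(* The limit 0 holds almost everywhere, and the constant 1 is an integrable bound because [mu] is
   finite. *)
have [|||||_ _ phi_int] := @dominated_convergence _ (borel G) R mu setT measurableT
  (fun j x => (phi j x)%:E) (cst 0%E) (cst 1%E).
- by move=> j; exact: measurable_int (continuous_integrable mu (phi_cont j)).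
- exact: measurable_cst.
- apply: (@filterS _ _ (ae_filter_ringOfSetsType mu) _ _ _ (haar_ae_notin s)).
  move=> x xs _.
  by apply: cvg_EFin; [exact: nearW|exact: phi_to0].
- by apply: (continuous_integrable mu (h := cst 1)); exact: cst_continuous.
- by apply: aeW => x j _; rewrite /= lee_fin ger0_norm//; case/andP: (phi01 j x).
move: phi_int; rewrite integral_cst// mul0e => /fine_cvg /cvgr_lt /(_ _ e0).
move=> /(@filter_ex _ _ _)[j jlt]; exists (phi j); split => // p ps.
by rewrite /phi /P (big_rem p)//= gdistxx mul0r mulr0 addr0 invr1.
Qed.

End haar_bump.

(** * Real numbers inside the scalar field *)

Section scalars.
Context (R : realType) (k : scalar_kind).

Lemma modulus_of_real (r : R) : modulus (of_real k r) = `|r|.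
Proof. by case: k => //=; rewrite expr0n addr0 sqrtr_sqr. Qed.

Lemma modulusN (z : scalar_field R k) : modulus (- z) = modulus z.
Proof. by rewrite -sub0r modulusB subr0. Qed.

(** A positive element of [R[i]] has zero imaginary part. Radii of balls over either scalar field
    can thus be treated as real numbers. *)
Lemma gt0_scalar_of_real (e : scalar_field R k) : 0 < e ->
  exists2 r : R, 0 < r & e = of_real k r.
Proof.
move=> e0; exists (modulus e); last by rewrite of_real_modulus gtr0_norm.
by rewrite -(ltr_of_real k) of_real_modulus of_real0 gtr0_norm.
Qed.

Lemma of_realB (a b : R) : of_real k (a - b) = of_real k a - of_real k b.
Proof. by apply/eqP; rewrite eq_sym subr_eq -of_realD subrK. Qed.

Lemma of_real_continuous : continuous (@of_real R k).
Proof.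
move=> x; apply/(@cvgrPdist_lt _ _ _ _ (nbhs_filter x)).
move=> _ /gt0_scalar_of_real[e e0 ->].
apply: filterS (nbhsx_ballx x e e0) => y; rewrite -ball_normE /=.
by rewrite -of_realB -of_real_modulus ltr_of_real modulus_of_real.
Qed.

End scalars.

(** * Small mean-zero perturbations with large Birkhoff sums *)

Section perturbation.
Context (R : realType) (k : scalar_kind) (G : compactMetricZmodType R).
Variable mu : probability (borel G) R.

Lemma scalar_integral_of_real (h : G -> R) :
  scalar_integral mu (fun x => of_real k (h x)) =
  of_real k (\int[mu]_(x in [set: borel G]) h x).
Proof.
rewrite /scalar_integral; case: k => //=.
by apply/eqP; rewrite eq_complex /= Rintegral_cst// mul0r !eqxx.
Qed.

Lemma birkhoff_sumD n u x (f g : contMeanZero k mu) :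
  birkhoff_sum n u (f + g) x = birkhoff_sum n u f x + birkhoff_sum n u g x.
Proof. exact: big_split. Qed.

Lemma birkhoff_sumN n u x (f : contMeanZero k mu) :
  birkhoff_sum n u (- f) x = - birkhoff_sum n u f x.
Proof. exact: sumrN. Qed.

Lemma modulus_birkhoff_sum_le n u x (f : contMeanZero k mu) :
  modulus (birkhoff_sum n u f x) <= n%:R * supnorm f.
Proof.
rewrite /birkhoff_sum; elim: n => [|n IHn].
  by rewrite big_ord0 mul0r -(ler_of_real k) of_real_modulus of_real0 normr0.
rewrite big_ord_recr /= -natr1 mulrDl mul1r.
by apply: le_trans (modulusD _ _) _; rewrite lerD// le_supnorm.
Qed.

Lemma supnormN (f : contMeanZero k mu) : supnorm (- f) = supnorm f.
Proof. by apply: (@of_real_inj _ k); exact: (normrN f). Qed.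

Hypotheses (mu_haar : is_haar mu) (infG : infinite_set [set: G]).

(** Take a bump [phi] with mean m < 1/2 and set h = e (phi - m). Since [phi] and m lie in [0, 1],
    |h| <= e, and on [s] the value is c = e (1 - m) >= e/2. *)
Lemma mean_zero_plateau (s : seq G) (e : R) : 0 < e ->
  exists (h : contMeanZero k mu) (c : R),
    [/\ supnorm h <= e, e / 2 <= c & {in s, forall p, h p = of_real k c}].
Proof.
move=> e0; have e2 : 0 < 2^-1 :> R by rewrite invr_gt0.
have [phi [phi_cont phi01 phi1 phi_int]] := haar_bump mu_haar infG s e2.
set m := (\int[mu]_(x in [set: borel G]) phi x) in phi_int.
have m_ge0 : 0 <= m by apply: Rintegral_ge0 => x _; case/andP: (phi01 x).
pose h x := e * (phi x - m).
have h_cont : continuous h.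
  move=> x; apply: cvgM; first exact: cvg_cst.
  by apply: cvgB; [exact: phi_cont|exact: cvg_cst].
have h_int : \int[mu]_(x in [set: borel G]) h x = 0.
  have c0 : continuous (cst 0 : G -> R) by exact: cst_continuous.
  have c1 : continuous (cst 1 : G -> R) by exact: cst_continuous.
  have int_cst r : \int[mu]_(x in [set: borel G]) (cst r : G -> R) x = r.
    transitivity (r * fine (mu setT)); first exact: Rintegral_cst.
    by rewrite probability_setT mulr1.
  (* Linearity is applied to e phi - (e m) 1 + 0. *)
  have := Rintegral_lin3 mu e (- (e * m)) phi_cont c1 c0.
  rewrite !int_cst addr0 mulr1 -/m subrr => <-.
  by apply: eq_Rintegral => x _; rewrite /h /=; ring.
have hP : (fun x => of_real k (h x)) \in @mean_zero R k G mu.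
  apply/asboolP; split; last by rewrite scalar_integral_of_real h_int of_real0.
  by move=> x; apply: continuous_comp; [exact: h_cont|exact: of_real_continuous].
exists (ContMeanZero hP), (e * (1 - m)); split.
- apply: supnorm_le => x /=; rewrite modulus_of_real /h normrM gtr0_norm//.
  rewrite ler_piMr ?(ltW e0)// ler_norml; have /andP[] := phi01 x; lra.
- by rewrite ler_pM2l//; lra.
- by move=> p ps /=; rewrite /h phi1.
Qed.

(** With [h] equal to c along the orbit piece, the sums of f + h and f - h differ by 2 n c, so one
    of them has modulus at least n c. Repeated orbit points do no harm: each of the n terms of the
    sum of [h] is still c. *)
Lemma exists_large_birkhoff_sum (f : contMeanZero k mu) (u : G) n (e : R) :
  0 < e -> exists2 g : contMeanZero k mu,
    supnorm (f - g) <= e & n%:R * (e / 2) <= modulus (birkhoff_sum n u g 0).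
Proof.
move=> e0; have [h [c [he ec hc]]] :=
  mean_zero_plateau [seq u *+ m | m <- iota 0 n] e0.
have hn : birkhoff_sum n u h 0 = of_real k (n%:R * c).
  rewrite /birkhoff_sum (eq_bigr (fun=> of_real k c)) => [|m _].
    elim: n {hc} => [|n IHn]; first by rewrite big_ord0 mul0r of_real0.
    by rewrite big_ord_recr /= IHn -of_realD -natr1 mulrDl mul1r.
  by rewrite hc// add0r; apply: map_f; rewrite mem_iota /= add0n.
have two_sums : n%:R * c *+ 2 <=
    modulus (birkhoff_sum n u (f + h) 0) + modulus (birkhoff_sum n u (f - h) 0).
  rewrite -(modulusN (birkhoff_sum n u (f - h) 0)).
  apply: le_trans (modulusD _ _); rewrite !birkhoff_sumD birkhoff_sumN opprB.
  rewrite addrCA addrAC subrr add0r hn -of_realD modulus_of_real.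
  by rewrite -mulr2n ler_norm.
have nec : n%:R * (e / 2) <= n%:R * c by rewrite ler_wpM2l.
have [large|small] := leP (n%:R * c) (modulus (birkhoff_sum n u (f + h) 0)).
- exists (f + h); last exact: le_trans large.
  by rewrite opprD addrA subrr sub0r supnormN.
- exists (f - h); first by rewrite opprB addrC subrK.
  apply: le_trans nec _; lra.
Qed.

End perturbation.

(** The upper limit is an infimum of suprema over eventual sets, so each of these suprema is shown
    to exceed every real r. *)
Lemma limn_esup_pinfty (R : realType) (v : nat -> R) :
  (forall N, exists2 n, (N < n)%N & N%:R < v n) ->
  limn_esup (fun n => (v n)%:E) = +oo%E.
Proof.
move=> v_large; rewrite /limn_esup limf_esupE; apply/ereal_inf_pinfty.
move=> _ [V [N0 _ N0V] <-]; apply: eq_infty => r.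
(* The first argument of the maximum places n in the tail contained in [V], the second makes [v n]
   exceed r. *)
have [n] := v_large (maxn N0 (Num.truncn r).+1).
rewrite gtn_max => /andP[N0n _] vn; apply: le_ereal_sup_tmp.
exists (v n)%:E; first by exists n => //; apply: N0V; exact: ltnW.
rewrite lee_fin ltW// (lt_trans _ vn)// (lt_le_trans (truncnS_gt r))//.
by rewrite ler_nat leq_maxr.
Qed.

(** * Open dense conditions on functions and directions *)

Section residual.
Context (R : realType) (k : scalar_kind) (G : compactMetricZmodType R).
Variables (mu : probability (borel G) R) (psi : nat -> nat).
Hypotheses (mu_haar : is_haar mu) (infG : infinite_set [set: G]).
Hypothesis psi_gt0 : forall n : nat, (0 < n)%N -> (0 < psi n)%N.
Hypothesis psi_o :
  (fun n : nat => (psi n)%:R : R) =o_\oo (fun n : nat => n%:R : R).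

(** Here [N] bounds both the time and the quotient from below: holding for all [N] gives an infinite
    upper limit. The bound N < n also excludes n = 0, where [psi] may vanish. *)
Definition large_sum (N : nat) (f : contMeanZero k mu) (u : G) : Prop :=
  exists2 n, (N < n)%N & N%:R < modulus (birkhoff_sum n u f 0) / (psi n)%:R.

Lemma large_sum_open N f : open (large_sum N f).
Proof.
have -> : large_sum N f = \bigcup_(n in [set n | (N < n)%N])
    [set u | N%:R < modulus (birkhoff_sum n u f 0) / (psi n)%:R].
  by apply/seteqP; split=> u [n]; exists n.
apply: bigcup_open => n _.
apply: (open_comp (D := [set r : R | N%:R < r])); last exact: open_gt.
move=> u _; apply: cvgM; last exact: cvg_cst.
apply: (continuous_comp (f := fun u : G => birkhoff_sum n u f 0)).
  by apply: birkhoff_sum_continuous; exact: contMeanZero_continuous.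
exact: modulus_continuous.
Qed.

(** A witness (u, n) for f also serves all nearby g, because the sum at fixed u and n is n-Lipschitz
    in f for the sup norm. *)
Lemma large_sum_somewhere_open N (V : set G) :
  open [set f : contMeanZero k mu | V `&` large_sum N f !=set0].
Proof.
rewrite openE => f [u [Vu [n Nn fn]]].
have psin : 0 < (psi n)%:R :> R by rewrite ltr0n psi_gt0// (leq_ltn_trans _ Nn).
have n0 : 0 < n%:R :> R by rewrite ltr0n (leq_ltn_trans _ Nn).
move: fn; rewrite ltr_pdivlMr// => fn.
(* The slack in the strict inequality, divided by the Lipschitz constant n, is the radius. *)
pose d := (modulus (birkhoff_sum n u f 0) - N%:R * (psi n)%:R) / n%:R.
have d0 : 0 < d by rewrite divr_gt0// subr_gt0.
apply/nbhs_ballP; exists (of_real k d).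
  by rewrite /= -(of_real0 _ k) ltr_of_real.
move=> g; rewrite -ball_normE /= (ltr_of_real k) => fgd.
exists u; split => //; exists n => //; rewrite ltr_pdivlMr//.
have := modulus_birkhoff_sum_le n u 0 (f - g).
rewrite birkhoff_sumD birkhoff_sumN => fg_le.
have := modulusD (birkhoff_sum n u f 0 - birkhoff_sum n u g 0)
  (birkhoff_sum n u g 0).
rewrite subrK => tri.
have : n%:R * supnorm (f - g) <
    modulus (birkhoff_sum n u f 0) - N%:R * (psi n)%:R.
  by rewrite mulrC -ltr_pdivlMr.
lra.
Qed.

Lemma large_sum_somewhere_dense N (V : set G) : V !=set0 ->
  dense [set f : contMeanZero k mu | V `&` large_sum N f !=set0].
Proof.
move=> [u Vu] O [f Of] oO.
have /nbhs_ballP[_ /gt0_scalar_of_real[e e0 ->] ballO] : nbhs f O.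
  exact: open_nbhs_nbhs.
(* This constant gives (N + 1) psi(n) <= n e/4 for large n, and n e/4 is the lower bound obtained
   from a perturbation of size e/2. Using N + 1 in place of N makes the final inequality strict. *)
have c0 : 0 < e / 4 / N.+1%:R by rewrite !divr_gt0.
have /eqoP/(_ _ c0)[n0 _ n0P] := psi_o.
pose n := maxn n0 N.+1.
have Nn : (N < n)%N by rewrite leq_max leqnn orbT.
have psin : 0 < (psi n)%:R :> R by rewrite ltr0n psi_gt0// (leq_ltn_trans _ Nn).
have := n0P n (leq_maxl _ _); rewrite /= !ger0_norm// => psi_le.
have e2 : 0 < e / 2 by rewrite divr_gt0.
have [g fg gn] := exists_large_birkhoff_sum mu_haar infG f u n e2.
exists g; split.
  apply: ballO; rewrite -ball_normE /= (ltr_of_real k).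
  by apply: le_lt_trans fg _; lra.
exists u; split => //; exists n => //; rewrite ltr_pdivlMr//.
apply: lt_le_trans gn.
apply: (@lt_le_trans _ _ (N.+1%:R * (psi n)%:R)).
  by rewrite ltr_pM2r// ltr_nat.
rewrite mulrC -ler_pdivlMr//; apply: le_trans psi_le _.
suff -> : e / 4 / N.+1%:R * n%:R = n%:R * (e / 2 / 2) / N.+1%:R by [].
by field; rewrite ?(nat1r, natr1) pnatr_eq0.
Qed.

End residual.

(** * Countable intersection over thresholds and balls *)

Theorem corollary1p4 (R : realType) (k : scalar_kind)
  (G : compactMetricZmodType R)
  (G_nontrivial : exists x : G, x != 0)
  (G_connected : connected [set: G])
  (mu : probability (borel G) R)
  (mu_haar : is_haar mu)
  (psi : nat -> nat)
  (psi_gt0 : forall n : nat, (0 < n)%N -> (0 < psi n)%N)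
  (psi_o : (fun n : nat => (psi n)%:R : R) =o_\oo (fun n : nat => n%:R : R)) :
  exists RR : set (contMeanZero k mu),
    residual RR /\
    forall f : contMeanZero k mu, RR f ->
      residual [set u : G |
        limn_esup (fun n : nat =>
          (modulus (birkhoff_sum n u f 0) / (psi n)%:R)%:E) = +oo%E].
Proof.
have infG := connected_nontrivial_infinite G_connected G_nontrivial.
have net j : {s : seq G | forall x, exists2 p, p \in s & gdist x p < j.+1%:R^-1}.
  by apply/cid/finite_net; rewrite invr_gt0.
(* Indices beyond the length of the net give balls centred at 0; these are nonempty too. *)
pose center j i := nth 0 (sval (net j)) i.
pose V (t : nat * nat) := [set x : G | gdist x (center t.1 t.2) < t.1.+1%:R^-1].
have V_neq0 t : V t !=set0.
  by exists (center t.1 t.2); rewrite /V /= gdistxx invr_gt0.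
pose A (t : nat * (nat * nat)) :=
  [set f : contMeanZero k mu | V t.2 `&` large_sum psi t.1 f !=set0].
(* The countable family [A] is listed along the naturals, with the whole space at numbers that code
   no triple. *)
pose U n := if unpickle n is Some t then A t else setT.
exists (\bigcap_n U n); split.
  exists U; split => // n; rewrite /U; case: unpickle => [t|].
    split; [exact: large_sum_somewhere_open|exact: large_sum_somewhere_dense].
  by split; [exact: openT|move=> O [f Of] _; exists f].
move=> f Uf; exists (fun N => large_sum psi N f); split; last first.
  by move=> u fu; apply: limn_esup_pinfty => N; exact: fu.
move=> N; split; first exact: large_sum_open.
move=> O [x Ox] oO.
have : nbhs x O by exact: open_nbhs_nbhs.
rewrite nbhs_gdist => -[e /= e0 eO].
(* For density in [G], a net point p within e/2 of x is the centre of a ball of radius below e/2.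
   The good u in that ball is within e of x. *)
have e2 : 0 < e / 2 by rewrite divr_gt0.
have [j _ /(_ j (leqnn j)) je] := near_infty_natSinv_lt (PosNum e2).
have [p pnet xp] := svalP (net j) x.
have [u [/= up fu]] : (V (j, index p (sval (net j))) `&` large_sum psi N f) !=set0.
  have := Uf (pickle (N, (j, index p (sval (net j))))) I.
  by rewrite /U pickleK.
exists u; split => //; apply: eO => /=.
move: up; rewrite /V /center /= nth_index// => up.
have {}je : j.+1%:R^-1 < e / 2 by [].
move: (gdist_triangle x p u) xp up je; rewrite (gdist_sym p u).
by move: (j.+1%:R^-1) => d; lra.
Qed.
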